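(* Let $T(n)$ be the total number of toothpicks in the toothpick structure after $n$ stages. For all $n\ge1$, $$ \frac{T(n)}{n^2}\le \frac23+\frac{1}{3n}, $$ with equality if and only if $n=2^k-1$ for some integer $k$. Hence $\limsup_{n\to\infty} T(n)/n^2=2/3$.
   Context: A toothpick is a line segment of length $1$ in the plane. The toothpick structure: at stage $1$ place a single toothpick on the $y$-axis centered at the origin; an end of a toothpick is exposed if that point is neither an end nor the midpoint of any other toothpick; at each subsequent stage, for every exposed toothpick end, place a toothpick centered at that end and perpendicular to the toothpick having that end. $T(0)=0$. *)

(* Defs.v *)
From HB Require Import structures.
From mathcomp Require Import all_boot all_order all_algebra finmap.
From mathcomp Require Import all_classical all_reals all_analysis.

Set Implicit Arguments.
Unset Strict Implicit.
Unset Printing Implicit Defensive.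

Import Order.TTheory GRing.Theory Num.Theory.

Local Open Scope fset_scope.
Local Open Scope ring_scope.

(* An axis-parallel segment of length 1 in the plane, encoded by its midpoint
   and its direction (true: vertical, false: horizontal).  The structure starts
   with a vertical toothpick and only ever adds perpendicular ones, so no other
   directions occur. *)
Definition toothpick (R : realType) : choiceType := (R * R * bool)%type.

Definition midpoint (R : realType) (t : toothpick R) : R * R := t.1.

Definition vertical (R : realType) (t : toothpick R) : bool := t.2.

Definition half_vector (R : realType) (t : toothpick R) : R * R :=
  if vertical t then (0, 1 / 2) else (1 / 2, 0).

Definition ends (R : realType) (t : toothpick R) : seq (R * R) :=
  [:: midpoint t - half_vector t; midpoint t + half_vector t].

Definition exposed (R : realType) (S : {fset toothpick R})
    (t : toothpick R) (p : R * R) : bool :=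
  (p \in ends t) &&
  [forall t' : S, (val t' != t) ==>
     (p \notin ends (val t')) && (p != midpoint (val t'))].

Definition first_toothpick (R : realType) : toothpick R := ((0, 0), true).

Definition perp_at (R : realType) (t : toothpick R) (p : R * R) :
  toothpick R := (p, ~~ vertical t).

(* Exposure is tested against the structure before the stage: all the toothpicks
   of a stage are placed simultaneously. *)
Definition next_stage (R : realType) (S : {fset toothpick R}) :
    {fset toothpick R} :=
  S `|` [fset perp_at t p | t in S, p in ends t & exposed S t p].

Fixpoint structure_at (R : realType) (n : nat) : {fset toothpick R} :=
  match n with
  | 0 => fset0
  | 1 => [fset first_toothpick R]
  | m.+1 => next_stage (structure_at R m)
  end.

Definition T (R : realType) (n : nat) : nat := #|` structure_at R n|.

(* Main.v *)
Require Import Defs.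
From HB Require Import structures.
From mathcomp Require Import all_boot all_order all_algebra finmap.
From mathcomp Require Import all_classical all_reals all_analysis.
From mathcomp Require Import zify ring lra.
Import Order.TTheory GRing.Theory Num.Theory.

Set Implicit Arguments.
Unset Strict Implicit.
Unset Printing Implicit Defensive.

(* After doubling lengths, the toothpicks are points of Z^2, each having exactly
   two possible parents (its neighbours along one axis, chosen by parity); a
   toothpick is placed one stage after its first parent, and never if both
   parents appear simultaneously.  Birth times therefore satisfy a local rule.
   On a quadrant, the pattern of stage 4L consists of the pattern of stage 2L
   and three delayed copies of it, one of them a stage ahead of the others.
   Counting gives T(N + i) + 1 = T(N) + 2 T(i) + T(i + 1) for N = 2^j and
   0 < i < N.  By induction 3 T(n) <= 2 n^2 + n, with equality only through
   i + 1 = N, that is for n = 2^k - 1. *)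

(** * Birth times on a quadrant *)

(** The value [0] means never placed, so a delay must keep it. *)
Definition delay (s t : nat) : nat := if t == 0 then 0 else t + s.

Lemma delay_spec s t :
  (t = 0 /\ delay s t = 0) \/ (0 < t /\ delay s t = t + s).
Proof. by rewrite /delay; case: eqP => ?; [left|right]; lia. Qed.

(* Birth time [t] of a toothpick as a function of those of its two parents; the
   value [0] means that the toothpick is never placed. *)
Definition birth_rule (t t1 t2 : nat) : Prop :=
  (t1 = t2 /\ t = 0) \/
  (0 < t1 /\ (t2 = 0 \/ t1 < t2) /\ t = t1.+1) \/
  (0 < t2 /\ (t1 = 0 \/ t2 < t1) /\ t = t2.+1).

Definition ndist (m n : nat) : nat := (m - n) + (n - m).

(* [f] gives birth times on the quadrant [a, b >= 0] of a pattern symmetric in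
   both axes, so the neighbour of [0] at [-1] is read at [ndist 0 1 = 1]. *)
Definition local_rule (f : nat -> nat -> nat) (a b : nat) : Prop :=
  if odd (a + b) then birth_rule (f a b) (f a (ndist b 1)) (f a b.+1)
  else birth_rule (f a b) (f (ndist a 1) b) (f a.+1 b).

(* Once the pattern has filled [a < L, b <= L] at stage [2 * L], its only free
   toothpick end is at the corner [(L, L)].  From there one copy grows into the
   outer quadrant, its mirror image grows above the old region, and a copy
   rotated by a right angle and one stage ahead grows to its right. *)
Definition grow (L : nat) (f : nat -> nat -> nat) (a b : nat) : nat :=
  if (a < L) && (b <= L) then f a b
  else if b < L then delay (2 * L).-1 (f (L - b) (a - L).+1)
  else delay (2 * L) (f (ndist a L) (b - L)).

(** The invariant of doubling. [f] covers the first [2 * L] stages; the exact boundary values serve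
    to match the old region with the new copies. The rule omits the origin, whose toothpick has no
    parent. *)
Record pattern (L : nat) (f : nat -> nat -> nat) : Prop := Pattern {
  pat_even : exists2 m, 0 < m & L = 2 * m;
  pat_supp : forall a b, L <= a \/ L < b -> f a b = 0;
  pat_le : forall a b, f a b <= 2 * L;
  pat_ge3 : forall a b, 0 < a -> 0 < b -> f a b = 0 \/ 3 <= f a b;
  pat00 : f 0 0 = 1;
  pat01 : f 0 1 = 2;
  pat0y : forall b, 1 < b -> f 0 b = 0;
  patx0 : forall a, 0 < a -> f a 0 = 0;
  pat_top : forall a, a < L -> f a L = if odd a then 2 * L else 0;
  pat_right : forall b, b < L -> f L.-1 b = if odd b then (2 * L).-1 else 0;
  (* Makes the outer and the rotated copies of the next generation reach the row
     between them at equal times, so nothing is born there. *)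
  pat_diag : forall a, odd a -> f 1 a.+1 = delay 1 (f a 1);
  pat_rule : forall a b, a < L -> b <= L -> 0 < a + b -> local_rule f a b
}.

(** * Doubling a pattern *)

Section Grow.
Variables (L : nat) (f : nat -> nat -> nat).
Hypothesis pf : pattern L f.

Lemma growA a b : a < L -> b <= L -> grow L f a b = f a b.
Proof. by rewrite /grow => -> ->. Qed.

Lemma growB a b : L <= a -> b < L ->
  grow L f a b = delay (2 * L).-1 (f (L - b) (a - L).+1).
Proof. by move=> La bL; rewrite /grow bL ltnNge La. Qed.

Lemma growC a b : L <= b -> L <= a \/ L < b ->
  grow L f a b = delay (2 * L) (f (ndist a L) (b - L)).
Proof.
move=> Lb h; rewrite /grow (ltnNge b) Lb /=; case: ifP => // /andP[h1 h2]; lia.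
Qed.

Lemma grow_supp a b : 2 * L <= a \/ 2 * L < b -> grow L f a b = 0.
Proof.
move=> h; have [m m0 Lm] := pat_even pf; rewrite /grow.
have s0 : forall s, delay s 0 = 0 by [].
case: ifP => h1; first lia.
by case: ifP => h2; rewrite (pat_supp pf) //; rewrite /ndist; lia.
Qed.

Lemma grow_le a b : grow L f a b <= 2 * (2 * L).
Proof.
have [m m0 Lm] := pat_even pf; rewrite /grow.
case: ifP => h1; first by have := pat_le pf a b; lia.
case: ifP => h2.
  have := pat_le pf (L - b) (a - L).+1.
  case: (delay_spec (2 * L).-1 (f (L - b) (a - L).+1)) => -[]; lia.
have := pat_le pf (ndist a L) (b - L).
case: (delay_spec (2 * L) (f (ndist a L) (b - L))) => -[]; lia.
Qed.

Lemma grow_ge3 a b : 0 < a -> 0 < b -> grow L f a b = 0 \/ 3 <= grow L f a b.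
Proof.
have [m m0 Lm] := pat_even pf => a0 b0; rewrite /grow.
case: ifP => h1; first exact: (pat_ge3 pf).
case: ifP => h2.
  case: (delay_spec (2 * L).-1 (f (L - b) (a - L).+1)) => -[]; lia.
case: (delay_spec (2 * L) (f (ndist a L) (b - L))) => -[]; lia.
Qed.

Lemma grow0y b : 1 < b -> grow L f 0 b = 0.
Proof.
have [m m0 Lm] := pat_even pf => b1.
have [h|h] := leqP b L; first by rewrite growA ?(pat0y pf) //; lia.
rewrite growC; try lia.
by rewrite (pat_supp pf) // /ndist; lia.
Qed.

Lemma growx0 a : 0 < a -> grow L f a 0 = 0.
Proof.
have [m m0 Lm] := pat_even pf => a0.
have [h|h] := ltnP a L; first by rewrite growA ?(patx0 pf) //; lia.
rewrite growB //; last lia.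
by rewrite (pat_supp pf) //; lia.
Qed.

Lemma grow_top a : a < 2 * L ->
  grow L f a (2 * L) = if odd a then 2 * (2 * L) else 0.
Proof.
have [m m0 Lm] := pat_even pf => aL.
rewrite growC; try lia.
have -> : 2 * L - L = L by lia.
have [h|h] := leqP L (ndist a L).
  rewrite (pat_supp pf); last by left.
  by have -> : odd a = false by rewrite /ndist in h; lia.
rewrite (pat_top pf) //.
have -> : odd (ndist a L) = odd a by rewrite /ndist; lia.
by case: ifP => _; rewrite /delay; case: eqP; lia.
Qed.

(** Below [L] this column is the top row of the rotated copy, above it the last column of the outer
    copy; both end at [2 * L + (2 * L).-1]. *)
Lemma grow_right b : b < 2 * L ->
  grow L f (2 * L).-1 b = if odd b then (2 * (2 * L)).-1 else 0.
Proof.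
have [m m0 Lm] := pat_even pf => bL.
have [h|h] := ltnP b L.
  rewrite growB; try lia.
  have -> : ((2 * L).-1 - L).+1 = L by lia.
  have [h1|h1] := leqP L (L - b).
    rewrite (pat_supp pf); last by left.
    by have -> : odd b = false by lia.
  rewrite (pat_top pf) //.
  have -> : odd (L - b) = odd b by lia.
  by case: ifP => _; rewrite /delay; case: eqP; lia.
rewrite growC; try lia.
have -> : ndist (2 * L).-1 L = L.-1 by rewrite /ndist; lia.
rewrite (pat_right pf); last lia.
have -> : odd (b - L) = odd b by lia.
by case: ifP => _; rewrite /delay; case: eqP; lia.
Qed.

(** For [a > L] both sides read the cell [(L - 1, a - L + 1)] of [f], in the mirror image and in the
    rotated copy, whose delays differ by one. *)
Lemma grow_diag a : odd a -> grow L f 1 a.+1 = delay 1 (grow L f a 1).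
Proof.
have [m m0 Lm] := pat_even pf => oa.
have [h|h] := ltnP a L; first by rewrite !growA ?(pat_diag pf) //; lia.
rewrite growC; try lia.
rewrite growB; try lia.
have -> : ndist 1 L = L - 1 by rewrite /ndist; lia.
have -> : a.+1 - L = (a - L).+1 by lia.
rewrite /delay; case: (f _ _ =P 0) => // h1; case: eqP; lia.
Qed.

Lemma birth_rule_delay s t t1 t2 :
  birth_rule t t1 t2 -> birth_rule (delay s t) (delay s t1) (delay s t2).
Proof.
rewrite /birth_rule.
case: (delay_spec s t) => -[? ->]; case: (delay_spec s t1) => -[? ->];
  case: (delay_spec s t2) => -[? ->]; lia.
Qed.

Lemma birth_rule0 t : birth_rule 0 t t.
Proof. by left. Qed.

Lemma birth_ruleC t t1 t2 : birth_rule t t1 t2 -> birth_rule t t2 t1.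
Proof. rewrite /birth_rule; lia. Qed.

(** The rule with second parent [0] forces [t1 < 2 * L], so a parent from the new copies comes too
    late. *)
Lemma birth_rule_late t t1 t2 :
  0 < t <= 2 * L -> t2 = 0 \/ 2 * L <= t2 ->
  birth_rule t t1 0 -> birth_rule t t1 t2.
Proof. rewrite /birth_rule; lia. Qed.

(** Only the top row and the last column have a parent among the new copies, and parity leaves just
    those of their sites that are filled by stage [2 * L]. *)
Lemma grow_ruleA a b : a < L -> b <= L -> 0 < a + b ->
  local_rule (grow L f) a b.
Proof.
have [m m0 Lm] := pat_even pf => aL bL ab0.
have := pat_rule pf aL bL ab0; rewrite /local_rule; case: ifP => par.
- rewrite (growA (b := b)) // (growA (b := ndist b 1)) //; last by rewrite /ndist; lia.
  have [h|h] := ltnP b L; first by rewrite growA //; lia.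
  have -> : f a b.+1 = 0 by rewrite (pat_supp pf) //; lia.
  apply: birth_rule_late.
    have -> : b = L by lia.
    by rewrite (pat_top pf) //; case: ifP; lia.
  rewrite growC; try lia.
  case: (delay_spec (2 * L) (f (ndist a L) (b.+1 - L))) => -[]; lia.
- rewrite (growA (a := a)) // (growA (a := ndist a 1)) //; last by rewrite /ndist; lia.
  have [h|h] := ltnP a.+1 L; first by rewrite growA //; lia.
  have -> : f a.+1 b = 0 by rewrite (pat_supp pf) //; lia.
  apply: birth_rule_late.
    have -> : a = L.-1 by lia.
    by rewrite (pat_right pf); [case: ifP|]; lia.
  rewrite growB; try lia.
  case: (pat_ge3 pf (a := L - b) (b := (a.+1 - L).+1)); try lia.
    by move=> ->; left.
  case: (delay_spec (2 * L).-1 (f (L - b) (a.+1 - L).+1)) => -[]; lia.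
Qed.

(** The rotation taking [(a, b)] to [(L - b, a - L + 1)] transports the rule of [f]; the work lies
    at the seams with the axis, the outer copy and the old region. *)
Lemma grow_ruleB a b : L <= a -> a < 2 * L -> b < L ->
  local_rule (grow L f) a b.
Proof.
have [m m0 Lm] := pat_even pf => La aL bL.
have [b0|b0] := posnP b.
  rewrite b0 /local_rule growx0; last lia.
  case: ifP => par; first by have -> : ndist 0 1 = 1 by []; exact: birth_rule0.
  by rewrite !growx0 //; [exact: birth_rule0|rewrite /ndist; lia].
have := pat_rule pf (a := L - b) (b := (a - L).+1).
have /[swap]/[apply] : L - b < L by lia.
have /[swap]/[apply] : (a - L).+1 <= L by lia.
have /[swap]/[apply] : 0 < L - b + (a - L).+1 by lia.
rewrite /local_rule.
(* A quarter turn exchanges the two directions, hence the parities. *)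
have -> : odd (L - b + (a - L).+1) = ~~ odd (a + b) by lia.
rewrite if_neg (growB La bL); case: ifP => par /(birth_rule_delay (2 * L).-1).
- rewrite (growB (b := ndist b 1)) //; last by rewrite /ndist; lia.
  have -> : L - ndist b 1 = (L - b).+1 by rewrite /ndist; lia.
  have [h|h] := ltnP b.+1 L.
    rewrite growB //; have -> : ndist (L - b) 1 = L - b.+1 by rewrite /ndist; lia.
    exact: birth_ruleC.
  have -> : ndist (L - b) 1 = 0 by rewrite /ndist; lia.
  (* The row [b = L] belongs to the outer copy, but both copies agree on it: [2 * L + 1] at the
     corner, [0] beyond. *)
  suff -> : grow L f a b.+1 = delay (2 * L).-1 (f 0 (a - L).+1) by exact: birth_ruleC.
  rewrite growC; try lia.
  have -> : b.+1 - L = 0 by lia.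
  have [e|e] := eqVneq a L.
    by rewrite e /ndist subnn addn0 (pat00 pf) (pat01 pf) /delay /=; lia.
  by rewrite (patx0 pf) ?(pat0y pf) // /ndist; lia.
- rewrite (growB (a := a.+1)) //; last lia.
  have -> : (a.+1 - L).+1 = (a - L).+2 by lia.
  have [e|e] := eqVneq a L; last first.
    rewrite growB //; last by rewrite /ndist; lia.
    suff -> : ndist (a - L).+1 1 = (ndist a 1 - L).+1 by [].
    by rewrite /ndist; lia.
  (* The left parent is in the old column [L - 1] at even [b], so it is never born, like the axis
     site of the rotated copy. *)
  have -> : ndist (a - L).+1 1 = 0 by rewrite /ndist; lia.
  rewrite (growA (a := ndist a 1)); try by rewrite /ndist; lia.
  have -> : ndist a 1 = L.-1 by rewrite /ndist; lia.
  rewrite (pat_right pf) //.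
  have -> : odd b = false by lia.
  by rewrite (patx0 pf) //; lia.
Qed.

Lemma grow_ruleC a b : L <= b -> L <= a \/ L < b -> a < 2 * L -> b <= 2 * L ->
  local_rule (grow L f) a b.
Proof.
have [m m0 Lm] := pat_even pf => Lb Lab aL bL.
have [a0|a0] := posnP a.
  rewrite a0 /local_rule grow0y; last lia.
  case: ifP => par; last by have -> : ndist 0 1 = 1 by []; exact: birth_rule0.
  by rewrite !grow0y //; [exact: birth_rule0|lia|rewrite /ndist; lia].
have [eb|eb] := eqVneq b L.
  rewrite eb /local_rule (growC (b := L)); try lia.
  rewrite subnn; have [ea|ea] := eqVneq a L.
    (* The corner is born at [2 * L + 1] from its left parent in the old top row; its right parent
       is never born. *)
    rewrite ea; have -> : ndist L L = 0 by rewrite /ndist; lia.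
    rewrite (pat00 pf).
    have -> : odd (L + L) = false by lia.
    rewrite growA; try by rewrite /ndist; lia.
    have -> : ndist L 1 = L.-1 by rewrite /ndist; lia.
    rewrite (pat_top pf); last lia.
    have -> : odd L.-1 by lia.
    rewrite growC; try lia.
    by rewrite subnn (patx0 pf) /delay /birth_rule /ndist /=; lia.
  rewrite (patx0 pf); last by rewrite /ndist; lia.
  case: ifP => par; last first.
    rewrite !growC; try by rewrite /ndist; lia.
    by rewrite subnn !(patx0 pf) /ndist; try lia; exact: birth_rule0.
  rewrite growB; try by rewrite /ndist; lia.
  rewrite growC; try lia.
  have -> : L - ndist L 1 = 1 by rewrite /ndist; lia.
  have -> : L.+1 - L = 1 by lia.
  have -> : ndist a L = a - L by rewrite /ndist; lia.
  rewrite (pat_diag pf) /=; last lia.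
  set t := f _ _; rewrite /delay; case: (t =P 0) => _ /=; first exact: birth_rule0.
  have -> : t + 1 + (2 * L).-1 = t + 2 * L by lia.
  case: eqP => ?; first lia.
  exact: birth_rule0.
have := pat_rule pf (a := ndist a L) (b := b - L).
have /[swap]/[apply] : ndist a L < L by rewrite /ndist; lia.
have /[swap]/[apply] : b - L <= L by lia.
have /[swap]/[apply] : 0 < ndist a L + (b - L) by rewrite /ndist; lia.
rewrite /local_rule.
have -> : odd (ndist a L + (b - L)) = odd (a + b) by rewrite /ndist; lia.
rewrite (growC Lb Lab); case: ifP => par /(birth_rule_delay (2 * L)).
- rewrite (growC (b := b.+1)); try lia.
  have -> : (b.+1 - L) = (b - L).+1 by lia.
  suff -> : grow L f a (ndist b 1) = delay (2 * L) (f (ndist a L) (ndist (b - L) 1)) by [].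
  have -> : ndist b 1 = b.-1 by rewrite /ndist; lia.
  have -> : ndist (b - L) 1 = b.-1 - L by rewrite /ndist; lia.
  (* A lower parent in the old top row has [a] even, so it is never born, as on the horizontal axis
     of the copy. *)
  have [h|h] := boolP ((a < L) && (b.-1 <= L)); last by rewrite growC //; lia.
  rewrite growA; try lia.
  have -> : b.-1 = L by lia.
  rewrite (pat_top pf); last lia.
  have -> : odd a = false by lia.
  by rewrite subnn (patx0 pf) // /ndist; lia.
- rewrite !growC; try lia.
  have [h|h] := leqP L a.
    have -> : ndist a.+1 L = (ndist a L).+1 by rewrite /ndist; lia.
    suff -> : ndist (ndist a 1) L = ndist (ndist a L) 1 by [].
    by rewrite /ndist; lia.
  (* In the mirror image the left and right parents trade places. *)
  have -> : ndist a.+1 L = ndist (ndist a L) 1 by rewrite /ndist; lia.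
  have -> : ndist (ndist a 1) L = (ndist a L).+1 by rewrite /ndist; lia.
  exact: birth_ruleC.
Qed.

Lemma grow_rule a b : a < 2 * L -> b <= 2 * L -> 0 < a + b ->
  local_rule (grow L f) a b.
Proof.
move=> aL bL ab0; have [h|h] := boolP ((a < L) && (b <= L)).
  by case/andP: h => ? ?; exact: grow_ruleA.
by have [h1|h1] := ltnP b L; [apply: grow_ruleB|apply: grow_ruleC]; lia.
Qed.

Lemma grow_pattern : pattern (2 * L) (grow L f).
Proof.
have [m m0 Lm] := pat_even pf.
split.
- by exists L => //; lia.
- exact: grow_supp.
- exact: grow_le.
- exact: grow_ge3.
- by rewrite growA ?(pat00 pf) //; lia.
- by rewrite growA ?(pat01 pf) //; lia.
- exact: grow0y.
- exact: growx0.
- exact: grow_top.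
- exact: grow_right.
- exact: grow_diag.
- exact: grow_rule.
Qed.

End Grow.

(** * Counting the doubled pattern *)

Definition quadrant_count (L : nat) (f : nat -> nat -> nat) (n : nat) : nat :=
  \sum_(1 <= a < L) \sum_(1 <= b < L.+1) (0 < f a b <= n).

Lemma lit_delay s t i : (0 < delay s t <= s + i) = (0 < t <= i).
Proof. case: (delay_spec s t) => -[? ->]; lia. Qed.

Section GrowCount.
Variables (L : nat) (f : nat -> nat -> nat) (i : nat).
Hypothesis pf : pattern L f.

Let lit a b : nat := 0 < grow L f a b <= 2 * L + i.

(** These columns hold the old region, complete at stage [2 * L], and the mirror image above it;
    reversing the sum undoes the reflection. *)
Lemma lit_left :
  \sum_(1 <= a < L) \sum_(1 <= b < (2 * L).+1) lit a b =
  quadrant_count L f (2 * L) + quadrant_count L f i.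
Proof.
have [m m0 Lm] := pat_even pf.
transitivity (\sum_(1 <= a < L) (\sum_(1 <= b < L.+1) (0 < f a b <= 2 * L) +
    \sum_(1 <= b < L.+1) (0 < f (1 + L - a.+1) b <= i))).
  apply: eq_big_nat => a /andP[a1 aL].
  rewrite (@big_cat_nat _ _ _ L.+1) //=; last lia.
  congr (_ + _).
    apply: eq_big_nat => b /andP[b1 bL]; rewrite /lit growA //.
    by have := pat_le pf a b; lia.
  rewrite -{1}(add1n L) big_addn; have -> : (2 * L).+1 - L = L.+1 by lia.
  apply: eq_big_nat => b /andP[b1 bL]; rewrite /lit growC //; try lia.
  rewrite lit_delay addnK; have -> // : ndist a L = 1 + L - a.+1 by rewrite /ndist; lia.
by rewrite big_split /=; congr (_ + _); rewrite [RHS]big_nat_rev.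
Qed.

(** The rotation turns rows into columns, hence the exchange of sums; its head start of one stage
    turns [i] into [i.+1]. *)
Lemma lit_right_down :
  \sum_(L <= a < 2 * L) \sum_(1 <= b < L) lit a b = quadrant_count L f i.+1.
Proof.
have [m m0 Lm] := pat_even pf.
rewrite exchange_big_nat /= big_nat_rev /=.
apply: eq_big_nat => b /andP[b1 bL].
rewrite -{1}(add0n L) big_addn; have -> : 2 * L - L = L by lia.
rewrite [RHS]big_add1 /=; apply: eq_big_nat => a /andP[_ aL].
rewrite /lit growB; try lia.
have -> : 2 * L + i = (2 * L).-1 + i.+1 by lia.
rewrite lit_delay addnK; have -> // : L - (1 + L - b.+1) = b by lia.
Qed.

(** The column [a = L] is the common axis of the outer copy and its mirror image; its two sites give
    [(0 < i) + (1 < i)]. *)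
Lemma lit_right_up :
  \sum_(L <= a < 2 * L) \sum_(L <= b < (2 * L).+1) lit a b =
  (0 < i) + (1 < i) + quadrant_count L f i.
Proof.
have [m m0 Lm] := pat_even pf.
rewrite -{1}(add0n L) big_addn; have -> : 2 * L - L = L by lia.
transitivity (\sum_(0 <= a < L) \sum_(0 <= b < L.+1) (0 < f a b <= i)).
  apply: eq_big_nat => a /andP[_ aL].
  rewrite -{1}(add0n L) big_addn; have -> : (2 * L).+1 - L = L.+1 by lia.
  apply: eq_big_nat => b /andP[_ bL]; rewrite /lit growC; try lia.
  by rewrite lit_delay addnK; have -> // : ndist (a + L) L = a by rewrite /ndist; lia.
rewrite big_ltn; last lia.
congr (_ + _).
  rewrite big_ltn // big_ltn; last lia.
  rewrite big_nat_cond big1 ?addn0 ?(pat00 pf) ?(pat01 pf) //.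
  by move=> b; rewrite andbT => /andP[b1 _]; rewrite (pat0y pf).
apply: eq_big_nat => a /andP[a1 _].
by rewrite big_ltn // (patx0 pf).
Qed.

Lemma grow_count :
  quadrant_count (2 * L) (grow L f) (2 * L + i) =
  quadrant_count L f (2 * L) + quadrant_count L f i.+1 +
  2 * quadrant_count L f i + (0 < i) + (1 < i).
Proof.
have [m m0 Lm] := pat_even pf.
rewrite {1}/quadrant_count (@big_cat_nat _ _ _ L) /=; try lia.
rewrite lit_left.
have -> : \sum_(L <= a < 2 * L) \sum_(1 <= b < (2 * L).+1) lit a b =
  \sum_(L <= a < 2 * L) (\sum_(1 <= b < L) lit a b +
     \sum_(L <= b < (2 * L).+1) lit a b).
  by apply: eq_bigr => a _; rewrite -big_cat_nat //; lia.
rewrite big_split /= lit_right_down lit_right_up; lia.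
Qed.

End GrowCount.

Lemma quadrant_count_max L f n : pattern L f -> 2 * L <= n ->
  quadrant_count L f n = quadrant_count L f (2 * L).
Proof.
move=> pf Ln; apply: eq_bigr => a _; apply: eq_bigr => b _.
by have := pat_le pf a b; lia.
Qed.

(** The base is the quadrant after stage 4, with [L = 2]; [birth k] describes the first [2 ^ k.+2]
    stages. *)
Fixpoint birth (k : nat) : nat -> nat -> nat :=
  if k is k'.+1 then grow (2 ^ k) (birth k')
  else fun a b => match a, b with
       | 0, 0 => 1 | 0, 1 => 2 | 1, 1 => 3 | 1, 2 => 4 | _, _ => 0 end.

Lemma birthS k : birth k.+1 = grow (2 ^ k.+1) (birth k).
Proof. by []. Qed.

Lemma birth_pattern k : pattern (2 ^ k.+1) (birth k).
Proof.
elim: k => [|k IH]; last by rewrite expnS; exact: grow_pattern.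
rewrite expn1; split=> /=.
- by exists 1.
- by case=> [|[|a]] [|[|[|b]]] //= []; lia.
- by case=> [|[|a]] [|[|[|b]]].
- by case=> [|[|a]] [|[|[|b]]] //=; auto.
- by [].
- by [].
- by case=> [|[|b]].
- by case=> [|[|a]].
- by case=> [|[|a]].
- by case=> [|[|b]].
- by case=> [|[|a]].
- by case=> [|[|a]] [|[|[|b]]] //= _ _ _; rewrite /local_rule /birth_rule /=; lia.
Qed.

(** * From the quadrant to the whole lattice *)

Lemma sum_sym_range M (g : nat -> nat) :
  \sum_(x <- map Posz (iota 0 M) ++ map Negz (iota 0 M)) g (absz x) =
  \sum_(0 <= a < M) g a + \sum_(1 <= a < M.+1) g a.
Proof.
rewrite big_cat !big_map big_add1 /= /index_iota !subn0; congr addn.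
Qed.

Section Plane.
Variables (L : nat) (f : nat -> nat -> nat).
Hypothesis pf : pattern L f.

(** Birth times become a recursion on stages: a site joins when exactly one parent is present. The
    bound on [n] stops before the corner [(L, L)] is due, at stage [2 * L + 1]. *)
Lemma lit_succ n a b : 0 < n -> n < 2 * L ->
  (0 < f a b <= n.+1) = (0 < f a b <= n) ||
  (if odd (a + b) then (0 < f a (ndist b 1) <= n) (+) (0 < f a b.+1 <= n)
   else (0 < f (ndist a 1) b <= n) (+) (0 < f a.+1 b <= n)).
Proof.
have [m m0 Lm] := pat_even pf => n0 nL.
have [h|h] := boolP ((a < L) && (b <= L)).
  case/andP: h => aL bL; have [ab|ab] := posnP (a + b).
    have [-> ->] : a = 0 /\ b = 0 by lia.
    by rewrite (pat00 pf) n0.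
  have := pat_rule pf aL bL ab; rewrite /local_rule /birth_rule.
  by case: ifP => _; lia.
have out : L <= a \/ L < b by lia.
(* A site outside sees only the top row or the last column; by parity the entry seen is [0], or,
   from the corner, [2 * L], still unlit at stage [n]. *)
rewrite (pat_supp pf out) /=; case: ifP => par.
- rewrite (pat_supp pf (b := b.+1)); last lia.
  have [h1|h1] := boolP ((a < L) && (b == L.+1)); last first.
    by rewrite (pat_supp pf) //; rewrite /ndist; lia.
  have -> : ndist b 1 = L by rewrite /ndist; lia.
  rewrite (pat_top pf); last lia.
  by have -> : odd a = false by lia.
- rewrite (pat_supp pf (a := a.+1)); last lia.
  have [h1|h1] := boolP ((a == L) && (b <= L)); last first.
    by rewrite (pat_supp pf) //; rewrite /ndist; lia.
  have -> : ndist a 1 = L.-1 by rewrite /ndist; lia.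
  have [h2|h2] := eqVneq b L.
    rewrite h2 (pat_top pf); last lia.
    by case: ifP; lia.
  rewrite (pat_right pf); last lia.
  by have -> : odd b = false by lia.
Qed.

(** [s] runs from [- M.+1] to [M]; the vanishing of [g] at [M.+1] restores the symmetry. *)
Lemma sum_quadrants (g : nat -> nat -> nat) (M : nat) :
  let s := map Posz (iota 0 M.+1) ++ map Negz (iota 0 M.+1) in
  (forall b, g M.+1 b = 0) -> (forall a, g a M.+1 = 0) ->
  \sum_(x <- s) \sum_(y <- s) g (absz x) (absz y) =
  g 0 0 + 2 * (\sum_(1 <= b < M.+1) g 0 b + \sum_(1 <= a < M.+1) g a 0) +
  4 * \sum_(1 <= a < M.+1) \sum_(1 <= b < M.+1) g a b.
Proof.
move=> s gM gM'.
have side h : h M.+1 = 0 ->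
    \sum_(x <- s) h (absz x) = h 0 + 2 * \sum_(1 <= a < M.+1) h a.
  move=> hM; rewrite sum_sym_range big_ltn // [X in _ + X]big_nat_recr //= hM; lia.
under eq_bigr => x _ do rewrite (side (g (absz x))) //.
rewrite (side (fun a => g a 0 + 2 * \sum_(1 <= b < M.+1) g a b)).
  rewrite big_split /= -big_distrr /=; lia.
by rewrite gM big1 // => b _; rewrite gM.
Qed.

Definition lit n (p : int * int) := 0 < f (absz p.1) (absz p.2) <= n.

(* [Posz] and [Negz] together enumerate the integers from [- L.+1] to [L]. *)
Definition lit_points n : seq (int * int) :=
  let s := map Posz (iota 0 L.+1) ++ map Negz (iota 0 L.+1) in
  [seq p <- [seq (x, y) | x <- s, y <- s] | lit n p].

Lemma mem_lit_points n p : (p \in lit_points n) = lit n p.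
Proof.
rewrite mem_filter; case: (boolP (lit n p)) => lp; rewrite ?andTb ?andFb //.
have rng z : absz z <= L ->
    z \in map Posz (iota 0 L.+1) ++ map Negz (iota 0 L.+1).
  rewrite mem_cat; case: z => z zL; apply/orP; [left|right];
    by apply: map_f; rewrite mem_iota; lia.
have [h|h] := boolP ((absz p.1 < L) && (absz p.2 <= L)); last first.
  by move: lp; rewrite /lit; move: (absz p.1) (absz p.2) h => a b h; rewrite (pat_supp pf) //; lia.
case: p lp h => x y lp /andP[xL yL]; rewrite /= in xL yL.
apply/allpairsPdep; exists x, y; split=> //; apply: rng; lia.
Qed.

Lemma uniq_lit_points n : uniq (lit_points n).
Proof.
have us : uniq (map Posz (iota 0 L.+1) ++ map Negz (iota 0 L.+1)).
  rewrite cat_uniq !map_inj_uniq ?iota_uniq ?andbT; try by move=> ? ? [].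
  by rewrite andTb; apply/hasPn => _ /mapP[z _ ->]; apply/mapP => -[].
by apply/filter_uniq/allpairs_uniq_dep => // -[? ?] [? ?] _ _ /= [-> ->].
Qed.

(** The axes hold only the origin, born at stage 1, and [(0, 1)] and [(0, -1)], born at stage 2. *)
Lemma size_lit_points n :
  size (lit_points n) = (0 < n) + 2 * (1 < n) + 4 * quadrant_count L f n.
Proof.
have [m m0 Lm] := pat_even pf.
rewrite size_filter -sum1_count big_mkcond big_allpairs_dep /=.
rewrite (sum_quadrants (g := fun a b => if 0 < f a b <= n then 1 else 0)); first last.
- by move=> a; rewrite (pat_supp pf) //; right.
- by move=> b; rewrite (pat_supp pf) //; left.
rewrite (pat00 pf) /= [X in _ + 2 * (X + _)]big_ltn //; last lia.
rewrite (pat01 pf) /= [X in _ + 2 * (_ + X + _)]big_nat_cond.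
rewrite [X in _ + 2 * (_ + X + _)]big1; last first.
  by move=> b /andP[/andP[b1 _] _]; rewrite (pat0y pf).
rewrite [X in _ + 2 * (_ + X)]big_nat_cond [X in _ + 2 * (_ + X)]big1; last first.
  by move=> a /andP[/andP[a1 _] _]; rewrite (patx0 pf).
rewrite big_nat_recr /=; last lia.
rewrite [X in 4 * (_ + X)]big1 => [|b _]; last by rewrite (pat_supp pf) //; left.
have -> : \sum_(1 <= a < L) \sum_(1 <= b < L.+1) (if 0 < f a b <= n then 1 else 0) =
   quadrant_count L f n.
  by apply: eq_bigr => a _; apply: eq_bigr => b _; case: ifP.
by case: n => [|[|n]] //=; lia.
Qed.

End Plane.

Local Open Scope ring_scope.

(** * From segments of the plane to lattice points *)

Section Geometry.
Variable R : realType.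

Definition halve (z : int) : R := z%:~R / 2.

(* Lengths are doubled: midpoints become integer points, and the direction of a
   toothpick is the parity of the sum of its coordinates. *)
Definition tooth (p : int * int) : toothpick R :=
  ((halve p.1, halve p.2), ~~ odd (absz (p.1 + p.2)%R)).

(* The only possible toothpicks having the midpoint of [tooth p] as an end. *)
Definition parents (p : int * int) : (int * int) * (int * int) :=
  if odd (absz (p.1 + p.2)%R) then ((p.1, p.2 - 1), (p.1, p.2 + 1))
  else ((p.1 - 1, p.2), (p.1 + 1, p.2)).

Lemma halve_inj : injective halve.
Proof.
move=> x y /eqP; rewrite /halve -subr_eq0 -mulrBl mulf_eq0 invr_eq0 pnatr_eq0 orbF subr_eq0 => /eqP.
exact: intr_inj.
Qed.

Lemma halveD1 z : halve z + 1 / 2 = halve (z + 1).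
Proof. by rewrite /halve intrD; lra. Qed.

Lemma halveB1 z : halve z - 1 / 2 = halve (z - 1).
Proof. by rewrite /halve intrB; lra. Qed.

Lemma tooth_inj : injective tooth.
Proof. by move=> [x y] [x' y'] [/halve_inj -> /halve_inj ->]. Qed.

Lemma ends_tooth q : ends (tooth q) =
  if odd (absz (q.1 + q.2)%R)
  then [:: midpoint (tooth (q.1 - 1, q.2)); midpoint (tooth (q.1 + 1, q.2))]
  else [:: midpoint (tooth (q.1, q.2 - 1)); midpoint (tooth (q.1, q.2 + 1))].
Proof.
rewrite /ends /half_vector /vertical /midpoint /=; case: (odd _) => /=.
  by congr [:: _; _]; congr pair => /=; rewrite ?halveD1 ?halveB1 ?addr0 ?subr0.
by congr [:: _; _]; congr pair => /=; rewrite ?halveD1 ?halveB1 ?addr0 ?subr0.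
Qed.

Lemma midpoint_tooth_inj p q : midpoint (tooth p) = midpoint (tooth q) -> p = q.
Proof. by case: p q => [x y] [x' y'] [/halve_inj -> /halve_inj ->]. Qed.

Lemma mem_ends_tooth q r : (midpoint (tooth r) \in ends (tooth q)) =
  (q == (parents r).1) || (q == (parents r).2).
Proof.
case: q r => [x y] [x' y']; rewrite ends_tooth /parents.
have E p s : (midpoint (tooth p) == midpoint (tooth s)) = (p == s).
  by apply/eqP/eqP => [/midpoint_tooth_inj //|-> //].
case: ifP => o1; case: ifP => o2; rewrite !inE !E !xpair_eqE /= in o1 o2 *; lia.
Qed.

(** A step to a neighbouring site flips the parity, hence the direction, so the new toothpick is
    again a [tooth]. *)
Lemma ends_toothP q p : p \in ends (tooth q) ->
  exists2 r, p = midpoint (tooth r) & perp_at (tooth q) p = tooth r.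
Proof.
case: q => x y; rewrite ends_tooth; case: ifP => o; rewrite !inE => /orP[] /eqP ->;
  [exists (x - 1, y)|exists (x + 1, y)|exists (x, y - 1)|exists (x, y + 1)] => //;
  rewrite /perp_at /tooth /vertical /=; congr pair; lia.
Qed.

Lemma exposedP (S : {fset toothpick R}) t p :
  reflect (p \in ends t /\
           forall t', t' \in S -> t' != t -> p \notin ends t' /\ p != midpoint t')
          (exposed S t p).
Proof.
rewrite /exposed; apply: (iffP andP) => -[pt h]; split=> //.
  move=> t' t'S t't; move/forallP: h => /(_ [` t'S]%fset) /implyP /=.
  by move=> /(_ t't) /andP.
apply/forallP => t'; apply/implyP => t't; apply/andP.
exact: (h _ (valP t')).
Qed.

Lemma next_stageP (S : {fset toothpick R}) t :
  reflect (t \in S \/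
    exists t0 p, [/\ t0 \in S, exposed S t0 p & t = perp_at t0 p])
    (t \in next_stage S).
Proof.
rewrite /next_stage in_fsetU; apply: (iffP orP) => -[tS|h]; try by left.
  case/imfset2P: h => t0 /= t0S [p]; rewrite inE /= => /andP[pt ex] ->.
  by right; exists t0, p.
right; case: h => t0 [p [t0S ex ->]].
apply/imfset2P; exists t0 => //; exists p => //.
by rewrite inE /= ex andbT; case/andP: ex.
Qed.

(** Only the parents of a site can end at its point, and only its own toothpick can be centered
    there; so an exposed end at an empty site means exactly one parent in [P]. *)
Lemma next_stage_tooth (S : {fset toothpick R}) (P : pred (int * int)) :
  (forall t, t \in S <-> exists2 p, P p & t = tooth p) ->
  forall t, t \in next_stage S <->
    exists2 p, P p || (P (parents p).1 (+) P (parents p).2) & t = tooth p.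
Proof.
move=> SP t.
have inS p : (tooth p \in S) = P p.
  by apply/idP/idP => [/SP[q Pq /tooth_inj ->] //|Pp]; apply/SP; exists p.
have pne p : (parents p).1 != (parents p).2.
  by rewrite /parents; case: ifP => _; rewrite xpair_eqE /=; lia.
split=> [/next_stageP[/SP[p Pp ->]|]|[r]].
- by exists p; rewrite // Pp.
- move=> [_ [p [/SP[q Pq ->] /exposedP[pq alone] ->]]].
  have [r pr ->] := ends_toothP pq; exists r => //.
  move: pq; rewrite pr mem_ends_tooth => qr.
  have alone' q' : (q' == (parents r).1) || (q' == (parents r).2) -> q' != q ->
      ~~ P q'.
    move=> q'r q'q; apply/negP; rewrite -inS => q'S.
    have /(alone _ q'S)[] : tooth q' != tooth q by apply: contra q'q => /eqP/tooth_inj ->.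
    by rewrite pr mem_ends_tooth q'r.
  apply/orP; right; case/orP: qr => /eqP qE.
    rewrite -qE Pq (negbTE (alone' (parents r).2 _ _)) ?eqxx ?orbT //.
    by rewrite qE eq_sym.
  rewrite -qE Pq (negbTE (alone' (parents r).1 _ _)) ?eqxx ?orbT //.
  by rewrite qE.
- move=> h ->; apply/next_stageP.
  have [Pr|nPr] := boolP (P r); first by left; rewrite inS.
  right; rewrite (negbTE nPr) /= in h.
  have [q [Pq qr alone]] : exists q, [/\ P q,
      (q == (parents r).1) || (q == (parents r).2) &
      forall q', (q' == (parents r).1) || (q' == (parents r).2) -> P q' -> q' = q].
    have [P1|P1] := boolP (P (parents r).1).
      exists (parents r).1; rewrite eqxx; split=> // q' /orP[/eqP //|/eqP -> P2].
      by rewrite P1 P2 in h.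
    exists (parents r).2; rewrite eqxx orbT; split=> //.
      by rewrite (negbTE P1) in h.
    by move=> q' /orP[/eqP ->|/eqP //]; rewrite (negbTE P1).
  have rq : midpoint (tooth r) \in ends (tooth q) by rewrite mem_ends_tooth.
  exists (tooth q), (midpoint (tooth r)); split.
  + by rewrite inS.
  + apply/exposedP; split=> // t' /SP[q' Pq' ->] q'q; split.
      rewrite mem_ends_tooth; apply: contra q'q => q'r.
      by rewrite (alone _ q'r Pq').
    apply: contra nPr => /eqP/midpoint_tooth_inj ->//.
  + by have [s /midpoint_tooth_inj -> ->] := ends_toothP rq.
Qed.

Variables (L : nat) (f : nat -> nat -> nat).
Hypothesis pf : pattern L f.

Lemma lit_parents n p : (0 < n)%N -> (n < 2 * L)%N ->
  lit f n.+1 p = lit f n p || (lit f n (parents p).1 (+) lit f n (parents p).2).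
Proof.
case: p => x y n0 nL; rewrite /lit (lit_succ pf) //= /parents /=.
have -> : odd (absz x + absz y)%N = odd (absz (x + y)%R) by lia.
case: ifP => _ /=; congr (_ || _).
(* For a negative coordinate the absolute values of the two neighbours swap; the exclusive or is
   symmetric. *)
- have [[-> ->]|[-> ->]] // : (absz (y - 1)%R = ndist (absz y) 1 /\ absz (y + 1)%R = (absz y).+1) \/
    (absz (y - 1)%R = (absz y).+1 /\ absz (y + 1)%R = ndist (absz y) 1) by rewrite /ndist; lia.
  exact: addbC.
- have [[-> ->]|[-> ->]] // : (absz (x - 1)%R = ndist (absz x) 1 /\ absz (x + 1)%R = (absz x).+1) \/
    (absz (x - 1)%R = (absz x).+1 /\ absz (x + 1)%R = ndist (absz x) 1) by rewrite /ndist; lia.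
  exact: addbC.
Qed.

Lemma lit1 p : lit f 1 p = (p == (0, 0)).
Proof.
case: p => x y; rewrite /lit xpair_eqE /=.
have [x0|x0] := eqVneq x 0; have [y0|y0] := eqVneq y 0.
- by rewrite x0 y0 (pat00 pf).
- rewrite x0 /=; have [y1|y1] := eqVneq (absz y) 1%N.
    by rewrite y1 (pat01 pf).
  by rewrite (pat0y pf) //; lia.
- by rewrite y0 (patx0 pf) //; lia.
- by case: (pat_ge3 pf (a := absz x) (b := absz y)); lia.
Qed.

Lemma structure_lit n : (n <= 2 * L)%N ->
  forall t, t \in structure_at R n <-> exists2 p, lit f n p & t = tooth p.
Proof.
have tooth0 : tooth (0, 0) = first_toothpick R.
  by rewrite /tooth /first_toothpick /halve /= mul0r.
elim: n => [_ t|[_ _ t|n IH nL t]].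
- split; first by rewrite in_fset0.
  by case=> p; rewrite /lit; case: (f _ _).
- rewrite in_fset1 -tooth0; split=> [/eqP ->|[p]].
    by exists (0, 0); rewrite // lit1.
  by rewrite lit1 => /eqP -> ->.
- have -> : structure_at R n.+2 = next_stage (structure_at R n.+1) by [].
  rewrite (next_stage_tooth (IH (ltnW nL))).
  by split=> -[p hp ->]; exists p => //; move: hp; rewrite (@lit_parents n.+1).
Qed.

Lemma T_count n : (n <= 2 * L)%N ->
  T R n = ((0 < n) + 2 * (1 < n) + 4 * quadrant_count L f n)%N.
Proof.
move=> nL; rewrite -size_lit_points //.
rewrite /T; have -> : structure_at R n = [fset t in map tooth (lit_points L f n)]%fset.
  apply/fsetP => t; rewrite inE /=; apply/idP/idP.
    by move=> /(structure_lit nL)[p hp ->]; rewrite mem_map ?mem_lit_points //; exact: tooth_inj.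
  move=> /mapP[p]; rewrite mem_lit_points // => hp ->.
  by apply/(structure_lit nL); exists p.
by rewrite card_fseq undup_id ?size_map // map_inj_uniq ?uniq_lit_points //; exact: tooth_inj.
Qed.

End Geometry.

(** * The recurrence and the extremal values *)

Section Count.
Variable R : realType.
Local Open Scope nat_scope.

Lemma T1 : T R 1 = 1.
Proof. by rewrite (T_count R (birth_pattern 0)) // /quadrant_count unlock. Qed.

Lemma T2 : T R 2 = 3.
Proof. by rewrite (T_count R (birth_pattern 0)) // /quadrant_count unlock. Qed.

Lemma T3 : T R 3 = 7.
Proof. by rewrite (T_count R (birth_pattern 0)) // /quadrant_count unlock. Qed.

(** For [j = k.+2] this is [grow_count] with [L = 2 ^ k.+1], read through [T_count]; [j = 1] lies
    below the smallest pattern and is computed. *)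
Lemma T_rec j i : 0 < j -> 0 < i < 2 ^ j ->
  T R (2 ^ j + i) + 1 = T R (2 ^ j) + 2 * T R i + T R i.+1.
Proof.
case: j => [//|[|k]] _ ij.
  have -> : i = 1 by rewrite expn1 in ij; lia.
  by rewrite T1 T2 T3.
have pk := birth_pattern k; rewrite (expnS 2 k.+1) in ij *.
have ? : 0 < 2 ^ k.+1 by rewrite expn_gt0.
rewrite (@T_count R _ _ (birth_pattern k.+1) (2 * 2 ^ k.+1 + i)); last first.
  by rewrite (expnS 2 k.+1); lia.
rewrite !(T_count R pk); try lia.
rewrite (expnS 2 k.+1) birthS grow_count //; lia.
Qed.

(** At [i = 2 * L] every copy is complete, so [grow_count] yields T(2N) = 4 T(N) - 1 for N = 2L. *)
Lemma T_pow2 j : 3 * T R (2 ^ j) = 2 * (2 ^ j * 2 ^ j) + 1.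
Proof.
case: j => [|[|j]]; rewrite ?T1 ?T2 //; elim: j => [|k].
  by rewrite (T_count R (birth_pattern 0)) // /quadrant_count unlock.
have pk := birth_pattern k.
have ? : 0 < 2 ^ k.+1 by rewrite expn_gt0.
rewrite (expnS 2 k.+2) (expnS 2 k.+1) (T_count R pk) //.
rewrite (T_count R (birth_pattern k.+1)); last by rewrite (expnS 2 k.+1); lia.
rewrite (expnS 2 k.+1) (_ : 2 * (2 * 2 ^ k.+1) = 2 * 2 ^ k.+1 + 2 * 2 ^ k.+1) ?birthS; last lia.
rewrite grow_count //.
rewrite (quadrant_count_max pk (leqnSn _)); lia.
Qed.

Lemma pow2_between N j n : N = 2 ^ j -> N < n < 2 * N -> ~ exists k, n = 2 ^ k.
Proof.
move=> -> h [k nk]; move: h; rewrite nk -expnS !ltn_exp2l //; lia.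
Qed.

(** Strong induction through [T_rec], with [n = N + i] and [N] the largest power of two up to
    [n]. *)
Lemma T_bound n : 0 < n ->
  3 * T R n <= 2 * (n * n) + n /\
  (3 * T R n = 2 * (n * n) + n <-> exists j, n.+1 = 2 ^ j).
Proof.
have [m] := ubnP n; elim: m n => // m IH n nm n0.
have [n1|n1] := leqP n 1.
  have -> : n = 1 by lia.
  by rewrite T1; split=> //; split=> // _; exists 1.
pose j := trunc_log 2 n.
have Nn : 2 ^ j <= n by apply: trunc_logP.
have nN : n < 2 * 2 ^ j by rewrite -expnS; apply: trunc_log_ltn.
have j0 : 0 < j by rewrite /j trunc_log_gt0.
have [N NE] : exists N, N = 2 ^ j by eexists.
have N2 : 2 <= N by rewrite NE -{1}(expn1 2) leq_exp2l.
have TN := T_pow2 j.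
move: Nn nN TN; rewrite -NE => Nn nN TN.
have [i iE] : exists i, n = N + i by exists (n - N); lia.
have [i0|i0] := posnP i.
  have -> : n = N by lia.
  split; first lia.
  split; first lia.
  by move=> h; case: (pow2_between NE _ h); lia.
have := @T_rec j i j0; rewrite -NE -iE => /(_ ltac:(lia)) rec.
have [||bi eqi] := IH i; try lia.
have [||bi1 _] := IH i.+1; try lia.
(* At [i.+1 = N] the inductive bound on T(N) is too weak; its exact value from [T_pow2] gives
   equality. *)
have [iN|iN] := eqVneq i.+1 N.
  have eqi' : 3 * T R i = 2 * (i * i) + i by apply/eqi; exists j; rewrite iN.
  have eqn : 3 * T R n = 2 * (n * n) + n by rewrite iN in rec; nia.
  rewrite eqn; split=> //; split=> // _; exists j.+1; rewrite expnS -NE; lia.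
(* In terms of [d] the slack is [3 * i + 1 + d + 4 * i * d], which is positive. *)
have [d dE] : exists d, N = i + 2 + d by exists (N - i - 2); lia.
have lt : 3 * T R n < 2 * (n * n) + n.
  have {}rec : 3 * T R n + 3 <= 2 * (N * N) + 1 + 2 * (2 * (i * i) + i) +
    (2 * (i.+1 * i.+1) + i.+1) by lia.
  move: rec; rewrite iE dE; move: (T R _) => t; nia.
split; first exact: ltnW.
split=> h; first lia.
by case: (pow2_between NE _ h); lia.
Qed.

End Count.

(** * The real inequality and the upper limit *)

Lemma T_le (R : realType) n : (0 < n)%N ->
  (T R n)%:R / n%:R ^+ 2 <= 2 / 3 + 1 / (3 * n%:R) :> R.
Proof.
move=> n0; have [h _] := T_bound R n0.
have n0' : 0 < n%:R :> R by rewrite ltr0n.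
rewrite ler_pdivrMr ?exprn_gt0 //.
have -> : (2 / 3 + 1 / (3 * n%:R)) * n%:R ^+ 2 = (2 * (n%:R * n%:R) + n%:R) / 3 :> R.
  by field; rewrite gt_eqF.
by move: h; rewrite -(ler_nat R) natrD !natrM; lra.
Qed.

Lemma T_eq (R : realType) n : (0 < n)%N ->
  (T R n)%:R / n%:R ^+ 2 = 2 / 3 + 1 / (3 * n%:R) :> R <->
  exists j, n.+1 = (2 ^ j)%N.
Proof.
move=> n0; have [_ <-] := T_bound R n0.
have n0' : n%:R != 0 :> R by rewrite pnatr_eq0 -lt0n.
have -> : 2 / 3 + 1 / (3 * n%:R) = (2 * (n%:R * n%:R) + n%:R) / 3 / n%:R ^+ 2 :> R.
  by field.
split=> [/(mulIf _) h|h].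
  have {}h := h (invr_neq0 (expf_neq0 2 n0')).
  by apply/eqP; rewrite -(eqr_nat R) natrD !natrM h; apply/eqP; field.
congr (_ / _); have : (3 * T R n)%:R = (2 * (n * n) + n)%:R :> R by rewrite h.
by rewrite natrD !natrM => <-; field.
Qed.

Lemma nat_pow2_sub1P (R : realType) n : (0 < n)%N ->
  (exists k : int, n%:R = 2 ^ k - 1 :> R) <-> exists j, n.+1 = (2 ^ j)%N.
Proof.
move=> n0; split=> [[k]|[j nj]].
  have n0' : 0 < n%:R :> R by rewrite ltr0n.
  case: k => [j|j] nE.
    exists j; apply/eqP; rewrite -(eqr_nat R) natrX -natr1 nE.
    by rewrite -exprnP subrK.
  (* A negative exponent would give [n <= 0]. *)
  have : 2 ^ Negz j <= 1 :> R.
    by rewrite NegzE -exprnN invf_le1 ?exprn_gt0 // exprn_ege1 // ler1n.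
  lra.
exists (Posz j); rewrite -exprnP.
by have := congr1 (fun m => m%:R : R) nj; rewrite /= natrX -natr1 => <-; rewrite addrK.
Qed.

Lemma limsup_T (R : realType) :
  limn_esup (fun n : nat => ((T R n)%:R / n%:R ^+ 2)%:E : \bar R) = (2 / 3)%:E.
Proof.
apply/eqP; rewrite eq_le; apply/andP; split.
- apply/lee_addgt0Pr => e e0; rewrite /limn_esup limf_esupE.
  (* Beyond [e^-1] the excess [1 / (3 * n)] is below [e]. *)
  pose N := Num.bound e^-1.
  apply: (@le_trans _ _ (ereal_sup ((fun n : nat => ((T R n)%:R / n%:R ^+ 2)%:E : \bar R)
    @` [set n | (N < n)%N])%classic)).
    by apply: ereal_inf_lbound; exists [set n | (N < n)%N]%classic => //; exists N.+1.
  apply: ge_ereal_sup => _ [n /= Nn <-].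
  rewrite -EFinD lee_fin (le_trans (T_le _ _)) ?(leq_ltn_trans _ Nn) //.
  rewrite lerD2l.
  have n0 : 0 < n%:R :> R by rewrite ltr0n (leq_ltn_trans _ Nn).
  have h : e^-1 < n%:R.
    apply: lt_trans (archi_boundP _) _; first by rewrite invr_ge0 ltW.
    by rewrite ltr_nat.
  have h1 : 1 < e * n%:R by rewrite -ltr_pdivrMl // mulr1.
  by rewrite ler_pdivrMr; nra.
- rewrite /limn_esup limf_esupE; apply: le_ereal_inf_tmp => _ [V [N _ NV] <-].
  (* Every tail contains an equality case, where the quotient is at least [2 / 3]. *)
  have [n Nn nE] : exists2 n, (N < n)%N & n.+1 = (2 ^ N.+1)%N.
    exists (2 ^ N.+1).-1; last by rewrite prednK // expn_gt0.
    by have := ltn_expl N.+1 (ltnSn 1); lia.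
  have n0 : (0 < n)%N by exact: leq_ltn_trans Nn.
  apply: (@le_trans _ _ ((T R n)%:R / n%:R ^+ 2)%:E).
    rewrite lee_fin; have /(T_eq R n0) -> : exists j, n.+1 = (2 ^ j)%N by exists N.+1.
    by rewrite lerDl divr_ge0 // mulr_ge0.
  by apply: ereal_sup_ubound; exists n => //; apply: NV; exact: ltnW.
Qed.

Theorem theorem4 (R : realType) :
  (forall n : nat, (1 <= n)%N ->
     (T R n)%:R / n%:R ^+ 2 <= 2 / 3 + 1 / (3 * n%:R) :> R /\
     ((T R n)%:R / n%:R ^+ 2 = 2 / 3 + 1 / (3 * n%:R) :> R <->
      exists k : int, n%:R = 2 ^ k - 1 :> R)) /\
  limn_esup (fun n : nat => ((T R n)%:R / n%:R ^+ 2)%:E : \bar R) = (2 / 3)%:E.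
Proof.
split=> [n n0|]; last exact: limsup_T.
by split; [exact: T_le|rewrite nat_pow2_sub1P //; exact: T_eq].
Qed.
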